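(* For an integer $k\ge 1$ let $$M_k=(2k)^{1/6}\max_{x\in\mathbb{R}}\left((H_k(x))^2e^{-x^2}\right),$$ where $H_k$ is the Hermite polynomial of degree $k$, and let $$C_k=\frac{2k\sqrt{4k-2}\;(k!)^2}{\sqrt{8k^2-8k+3}\;((k/2)!)^2}\quad\text{if } k \text{ is even},$$ $$C_k=\frac{\sqrt{16k^2-16k+6}\;k!\,(k-1)!}{\sqrt{2k-1}\;\left(((k-1)/2)!\right)^2}\quad\text{if } k \text{ is odd}.$$ Then for every integer $k\ge 6$, $$\frac{27}{61}\,C_k<M_k<\frac{2}{3}\,C_k\,\exp\left(\frac{15}{8}\left(1+\frac{12}{4(2k)^{1/3}-9}\right)\right).$$
   Context: $H_k$ denotes the classical (physicists') Hermite polynomial of degree $k$ in Szegő's normalization, i.e. $H_k(x)=(-1)^k e^{x^2}\frac{d^k}{dx^k}e^{-x^2}$, with leading coefficient $2^k$; it satisfies $H_k''=2xH_k'-2kH_k$ and $H_k'=2kH_{k-1}$. *)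

(* Defs.v *)
From Stdlib Require Import Reals Arith.
From Coquelicot Require Import Coquelicot.
Open Scope R_scope.

(* Physicists' Hermite polynomial, by the Rodrigues formula. Every derivative
   of the Gaussian exists, so the total operator [Derive_n] is the genuine
   k-th derivative here. *)
Definition hermite (k : nat) (x : R) : R :=
  (-1) ^ k * exp (x ^ 2) * Derive_n (fun t : R => exp (- t ^ 2)) k x.

Definition is_maximum (f : R -> R) (m : R) : Prop :=
  (exists x : R, f x = m) /\ (forall x : R, f x <= m).

(* As a relation, so that the maximum is asserted to be attained;
   at most one [M] satisfies it for each [k]. *)
Definition is_M (k : nat) (M : R) : Prop :=
  exists m : R,
    is_maximum (fun x : R => hermite k x ^ 2 * exp (- x ^ 2)) m /\
    M = Rpower (2 * INR k) (1 / 6) * m.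

(* The divisions inside [fact] are on [nat] and exact in the relevant parity. *)
Definition Ck (k : nat) : R :=
  if Nat.even k then
    (2 * INR k * sqrt (4 * INR k - 2) * INR (fact k) ^ 2) /
    (sqrt (8 * INR k ^ 2 - 8 * INR k + 3) * INR (fact (k / 2)) ^ 2)
  else
    (sqrt (16 * INR k ^ 2 - 16 * INR k + 6) * INR (fact k)
       * INR (fact (k - 1))) /
    (sqrt (2 * INR k - 1) * INR (fact ((k - 1) / 2)) ^ 2).

(* Main.v *)
Require Import Defs.
From Stdlib Require Import Reals Arith Lra Lia.
From Coquelicot Require Import Coquelicot.
Open Scope R_scope.

(* The function [u = H_k exp (-x^2/2)] satisfies [u'' + (A - x^2) u = 0] with
   [A = 2k + 1]. A quadratic form in [u, u'] (the energy) increases on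
   [[0, sqrt A)], and its value at 0 is explicit and comparable to [C_k].
   At a critical point the energy is a known multiple of [u^2], so the lower
   bound follows from a critical point close to the turning point [sqrt A];
   the upper bound follows from a Gronwall estimate of the energy.
   The scale is [lam = (2 sqrt A)^(1/3)]: Sturm comparison with a cosine gives
   a critical point where [A - x^2] lies between [49/64 lam^2] and
   [25/9 lam^2], and a Riccati supersolution shows that [u^2] does not increase
   once [A - x^2 <= 49/64 lam^2]. *)

(** * Hermite polynomials by recurrence: derivatives, Rodrigues formula, parity, values at 0 *)

Fixpoint herm (n : nat) (x : R) : R :=
  match n with
  | O => 1
  | S m => 2 * x * herm m x -
           match m with O => 0 | S p => 2 * INR m * herm p x end
  end.

(** The derivative H_n' = 2n H_{n-1}. It equals the term subtracted in the recurrence, so that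
    H_{n+1} = 2x H_n - H_n'. *)
Definition dherm (n : nat) (x : R) : R :=
  match n with O => 0 | S p => 2 * INR n * herm p x end.

Lemma herm_S n x : herm (S n) x = 2 * x * herm n x - dherm n x.
Proof. now destruct n. Qed.

Lemma is_derive_combine f g x df dg c :
  is_derive f x df -> is_derive g x dg ->
  is_derive (fun t => 2 * t * f t - c * g t) x
    (2 * f x + 2 * x * df - c * dg).
Proof.
intros Hf Hg; auto_derive.
- split; [|split; [|easy]]; eexists; eassumption.
- rewrite (is_derive_unique (fun t : R => f t) x df Hf).
  rewrite (is_derive_unique (fun t : R => g t) x dg Hg); ring.
Qed.

(** The parameter [c] is 1 for the Rodrigues formula and 2 for the Hermite functions. *)
Lemma is_derive_mult_gauss f x df c :
  is_derive f x df ->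
  is_derive (fun t => f t * exp (- t ^ 2 / c)) x
    ((df - 2 * x / c * f x) * exp (- x ^ 2 / c)).
Proof.
intros Hf; auto_derive; [eexists; eassumption|].
rewrite (is_derive_unique (fun t : R => f t) x df Hf).
replace (- (x * (x * 1)) * / c) with (- x ^ 2 / c)
  by (unfold Rdiv; simpl; ring).
unfold Rdiv; ring.
Qed.

Lemma is_derive_herm n x : is_derive (herm n) x (dherm n x).
Proof.
(* The recurrence reaches two steps back, so the induction carries two consecutive degrees. *)
revert x; enough (forall x, is_derive (herm n) x (dherm n x) /\
  is_derive (herm (S n)) x (dherm (S n) x)) by (intro x; apply H).
induction n as [|n IH]; intros x.
- split.
  + apply (is_derive_const (K := R_AbsRing) (V := R_NormedModule) 1 x).
  + apply is_derive_ext with (fun t => 2 * t).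
    { intros t; simpl; ring. }
    auto_derive; [easy | simpl; ring].
- split; [apply IH|].
  replace (dherm (S (S n)) x) with
    (2 * herm (S n) x + 2 * x * dherm (S n) x - 2 * INR (S n) * dherm n x).
  + exact (is_derive_combine _ _ _ _ _ _ (proj2 (IH x)) (proj1 (IH x))).
  + change (dherm (S (S n)) x) with (2 * INR (S (S n)) * herm (S n) x).
    change (dherm (S n) x) with (2 * INR (S n) * herm n x).
    rewrite (S_INR (S n)), herm_S; ring.
Qed.

Lemma is_derive_dherm n x :
  is_derive (dherm n) x (2 * x * dherm n x - 2 * INR n * herm n x).
Proof.
destruct n as [|n].
- replace (_ - _) with 0 by (simpl; ring).
  apply (is_derive_const (K := R_AbsRing) (V := R_NormedModule) 0 x).
- replace (_ - _) with (2 * INR (S n) * dherm n x)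
    by (rewrite herm_S; cbn -[INR]; ring).
  apply (is_derive_scal (herm n)), is_derive_herm.
Qed.

(** Differentiating H_n exp(-x^2) gives (H_n' - 2x H_n) exp(-x^2) = -H_{n+1} exp(-x^2), so each
    derivative in the Rodrigues formula raises the degree by one and flips the sign. *)
Lemma hermite_herm n x : hermite n x = herm n x.
Proof.
assert (D : forall x, Derive_n (fun t => exp (- t ^ 2)) n x =
                      (-1) ^ n * herm n x * exp (- x ^ 2)).
{ clear x; induction n as [|n IH]; intros x.
  - simpl; ring.
  - change (Derive (Derive_n (fun t => exp (- t ^ 2)) n) x =
            (-1) ^ S n * herm (S n) x * exp (- x ^ 2)).
    rewrite (Derive_ext _ _ x IH).
    apply is_derive_unique.
    replace (_ * exp (- x ^ 2)) with
      ((-1) ^ n * ((dherm n x - 2 * x / 1 * herm n x) * exp (- x ^ 2 / 1))).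
    + apply is_derive_ext with
        (fun t => (-1) ^ n * (herm n t * exp (- t ^ 2 / 1))).
      { intros t; rewrite Rdiv_1_r; symmetry; apply Rmult_assoc. }
      apply is_derive_scal, is_derive_mult_gauss, is_derive_herm.
    + rewrite herm_S, !Rdiv_1_r, <- (tech_pow_Rmult (-1)); ring. }
unfold hermite; rewrite D.
transitivity ((-1 * -1) ^ n * (exp (x ^ 2) * exp (- x ^ 2)) * herm n x).
- rewrite Rpow_mult_distr; ring.
- rewrite <- exp_plus, Rplus_opp_r, exp_0.
  replace (-1 * -1) with 1 by ring; rewrite pow1; ring.
Qed.

Lemma herm_opp n x : herm n (- x) = (-1) ^ n * herm n x.
Proof.
enough (herm n (- x) = (-1) ^ n * herm n x /\
        herm (S n) (- x) = (-1) ^ S n * herm (S n) x) by apply H.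
induction n as [|n [IH1 IH2]].
- split; simpl; ring.
- split; [easy|].
  rewrite (herm_S (S n)), (herm_S (S n) x); cbn [dherm].
  rewrite IH1, IH2; simpl; ring.
Qed.

Lemma herm_even_0 n :
  herm (2 * n) 0 = (-1) ^ n * (INR (fact (2 * n)) / INR (fact n)).
Proof.
induction n as [|n IH].
- simpl; field.
- replace (2 * S n)%nat with (S (S (2 * n))) by lia.
  rewrite herm_S; cbn [dherm]; rewrite IH.
  rewrite !fact_simpl, !mult_INR, !S_INR, mult_INR.
  cbn [pow INR]; field.
  pose proof (pos_INR n); split; [apply INR_fact_neq_0 | lra].
Qed.

Lemma herm_odd_0 n : herm (S (2 * n)) 0 = 0.
Proof.
induction n as [|n IH].
- simpl; ring.
- replace (2 * S n)%nat with (S (S (2 * n))) by lia.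
  rewrite herm_S; cbn [dherm]; rewrite IH; ring.
Qed.

(** * Gaussian decay at infinity *)

Lemma pow_le_exp_sqr m : exists K, forall x, 1 <= x -> x ^ m <= K * exp (x ^ 2 / 2).
Proof.
destruct m as [|m].
- exists 1; intros x _; simpl pow at 1.
  pose proof (exp_ineq1_le (x ^ 2 / 2)); pose proof (pow2_ge_0 x); lra.
- set (c := INR (S m)).
  assert (c0 : 0 < c) by (apply lt_0_INR; lia).
  (* From 1 + y <= exp y at y = x^2/(2c), one gets x <= x^2 <= 2c exp(x^2/(2c)); raise this to the
     power c = m + 1. *)
  exists ((2 * c) ^ S m); intros x x1.
  replace (exp (x ^ 2 / 2)) with (exp (x ^ 2 / (2 * c)) ^ S m).
  2: { rewrite <- Rpower_pow by apply exp_pos; unfold Rpower.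
       rewrite ln_exp; fold c; f_equal; field; lra. }
  rewrite <- Rpow_mult_distr; apply pow_incr; split; [lra|].
  pose proof (exp_ineq1_le (x ^ 2 / (2 * c))).
  apply Rle_trans with (2 * c * (x ^ 2 / (2 * c))).
  + replace (2 * c * _) with (x * x) by (field; lra); nra.
  + apply Rmult_le_compat_l; lra.
Qed.

(** The factor [x ^ m] stays arbitrary in the induction because the term 2x H_n of the recurrence
    raises it by one. *)
Lemma herm_decay n m : exists K, forall x, 1 <= x ->
  Rabs (x ^ m * (herm n x * exp (- x ^ 2 / 2))) <= K.
Proof.
revert m; enough (forall m,
  (exists K, forall x, 1 <= x ->
    Rabs (x ^ m * (herm n x * exp (- x ^ 2 / 2))) <= K) /\
  (exists K, forall x, 1 <= x ->
    Rabs (x ^ m * (herm (S n) x * exp (- x ^ 2 / 2))) <= K))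
  by (intro m; apply H).
assert (B : forall m, exists K, forall x, 1 <= x ->
    Rabs (x ^ m * (1 * exp (- x ^ 2 / 2))) <= K).
{ intros m; destruct (pow_le_exp_sqr m) as [K HK].
  exists K; intros x x1; specialize (HK x x1).
  pose proof (pow_lt x m ltac:(lra)); pose proof (exp_pos (- x ^ 2 / 2)).
  rewrite Rabs_pos_eq by nra.
  replace K with (K * exp (x ^ 2 / 2) * exp (- x ^ 2 / 2)).
  - rewrite Rmult_1_l; apply Rmult_le_compat_r; lra.
  - rewrite Rmult_assoc, <- exp_plus.
    replace (x ^ 2 / 2 + - x ^ 2 / 2) with 0 by field; rewrite exp_0; ring. }
induction n as [|n IH]; intros m.
- split; [apply B|].
  destruct (B (S m)) as [K HK]; exists (2 * K); intros x x1.
  replace (x ^ m * _) with (2 * (x ^ S m * (1 * exp (- x ^ 2 / 2))))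
    by (simpl; ring).
  rewrite Rabs_mult, (Rabs_pos_eq 2) by lra.
  apply Rmult_le_compat_l; [lra | now apply HK].
- split; [apply IH|].
  destruct (IH m) as [[K HK] _]; destruct (IH (S m)) as [_ [L HL]].
  exists (2 * L + 2 * INR (S n) * K); intros x x1.
  rewrite herm_S; cbn [dherm].
  replace (x ^ m * _) with
    (2 * (x ^ S m * (herm (S n) x * exp (- x ^ 2 / 2)))
     + - (2 * INR (S n) * (x ^ m * (herm n x * exp (- x ^ 2 / 2)))))
    by (cbn [pow]; ring).
  pose proof (pos_INR (S n)).
  eapply Rle_trans; [apply Rabs_triang|].
  rewrite Rabs_Ropp, !(Rabs_mult (2 * _)), !(Rabs_mult 2).
  rewrite (Rabs_pos_eq 2), (Rabs_pos_eq (INR (S n))) by lra.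
  specialize (HK x x1); specialize (HL x x1).
  apply Rplus_le_compat; apply Rmult_le_compat_l; lra.
Qed.

(** * Hermite functions and their differential equation *)

Definition psi (n : nat) (x : R) : R := herm n x * exp (- x ^ 2 / 2).
Definition dpsi (n : nat) (x : R) : R :=
  (dherm n x - x * herm n x) * exp (- x ^ 2 / 2).

Lemma is_derive_psi n x : is_derive (psi n) x (dpsi n x).
Proof.
unfold dpsi; replace (dherm n x - _) with (dherm n x - 2 * x / 2 * herm n x)
  by field.
apply is_derive_mult_gauss, is_derive_herm.
Qed.

Lemma is_derive_dpsi n x :
  is_derive (dpsi n) x (- (2 * INR n + 1 - x ^ 2) * psi n x).
Proof.
unfold psi; rewrite <- Rmult_assoc.
replace (- _ * _) with
  (2 * x * dherm n x - 2 * INR n * herm n x - (1 * herm n x + x * dherm n x)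
   - 2 * x / 2 * (dherm n x - x * herm n x)) by field.
apply (is_derive_mult_gauss (fun t => dherm n t - t * herm n t)).
apply (is_derive_minus (dherm n) (fun t => t * herm n t));
  [apply is_derive_dherm|].
apply (is_derive_mult (fun t => t) (herm n));
  [apply (is_derive_id (K := R_AbsRing)) | apply is_derive_herm | apply Rmult_comm].
Qed.

(** * Riccati supersolutions and the decaying tail of a solution *)

Lemma derive_nonneg_le (f df : R -> R) p q :
  p <= q -> (forall x, p <= x <= q -> is_derive f x (df x)) ->
  (forall x, p <= x <= q -> 0 <= df x) -> f p <= f q.
Proof.
intros pq D P.
destruct (MVT_gen f p q df) as [c [Hc E]];
  rewrite ?Rmin_left, ?Rmax_right in * by lra.
- intros x Hx; apply D; lra.
- intros x Hx; apply derivable_continuous_pt.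
  exists (df x); apply is_derive_Reals, D; lra.
- pose proof (P c Hc); nra.
Qed.

Definition solution (A : R) (u v : R -> R) : Prop :=
  forall x, is_derive u x (v x) /\ is_derive v x (- (A - x ^ 2) * u x).

(** These bounds make u v and u^2 of order 1/x, which is enough to control the quantities u v + c
    u^2 at infinity. *)
Definition decaying (u v : R -> R) : Prop :=
  exists K, forall x, 1 <= x -> Rabs (x * u x) <= K /\ Rabs (v x) <= K.

Lemma solution_opp A u v :
  solution A u v -> solution A (fun x => - u x) (fun x => - v x).
Proof.
intros S x; destruct (S x) as [Su Sv]; split.
- now apply (is_derive_opp u).
- replace (_ * _) with (- (- (A - x ^ 2) * u x)) by ring.
  now apply (is_derive_opp v).
Qed.

(* The derivative of [u v + r u^2] is [(v + r u)^2 + (r' - r^2 - (A - x^2)) u^2]. *)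
Lemma riccati_monotone A u v r dr p q :
  solution A u v -> p <= q ->
  (forall x, is_derive r x (dr x)) ->
  (forall x, p <= x <= q -> r x ^ 2 + (A - x ^ 2) <= dr x) ->
  u p * v p + r p * u p ^ 2 <= u q * v q + r q * u q ^ 2.
Proof.
intros S pq Dr Hr.
apply derive_nonneg_le with (f := fun x => u x * v x + r x * u x ^ 2)
  (df := fun x => (v x + r x * u x) ^ 2
                  + (dr x - r x ^ 2 - (A - x ^ 2)) * u x ^ 2); [easy| |].
- intros x _; destruct (S x) as [Su Sv].
  auto_derive.
  + repeat split; eexists; first [exact Su | exact Sv | exact (Dr x)].
  + rewrite (is_derive_unique (fun t : R => u t) x _ Su),
      (is_derive_unique (fun t : R => v t) x _ Sv),
      (is_derive_unique (fun t : R => r t) x _ (Dr x)); ring.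
- intros x Hx; specialize (Hr x Hx).
  pose proof (pow2_ge_0 (v x + r x * u x)); pose proof (pow2_ge_0 (u x)); nra.
Qed.

(** The constant c is a Riccati supersolution beyond p, so P = u v + c u^2 does not decrease there.
    If P were positive at p it would stay bounded away from 0, against the decay. *)
Lemma decaying_nonpos A u v c p :
  solution A u v -> decaying u v -> 0 <= c ->
  (forall x, p <= x -> c ^ 2 + (A - x ^ 2) <= 0) ->
  u p * v p + c * u p ^ 2 <= 0.
Proof.
intros S [K HK] c0 Hc.
set (P := fun x => u x * v x + c * u x ^ 2).
change (P p <= 0).
destruct (Rle_or_lt (P p) 0) as [|Pp]; [easy|exfalso].
assert (B : forall x, 1 <= x -> P x * x <= K * K + c * (K * K)).
{ intros x x1; destruct (HK x x1) as [H1 H2].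
  apply Rabs_le_between in H1; apply Rabs_le_between in H2.
  assert (x * u x * v x <= K * K) by nra.
  assert ((x * u x) * (x * u x) <= K * K) by nra.
  assert (x * u x ^ 2 <= K * K) by (pose proof (pow2_ge_0 (u x)); nra).
  unfold P.
  pose proof (Rmult_le_compat_l c _ _ c0 H3).
  lra. }
set (L := K * K + c * (K * K)) in *.
(* At this point P(p) x >= L + 1, while P(p) x <= P(x) x <= L. *)
set (x := Rmax (Rmax p 1) ((L + 1) / P p)).
assert (px : p <= x) by (eapply Rle_trans; [apply Rmax_l|apply Rmax_l]).
assert (x1 : 1 <= x) by (eapply Rle_trans; [apply Rmax_r|apply Rmax_l]).
assert (xL : (L + 1) / P p <= x) by apply Rmax_r.
specialize (B x x1).
assert (M : P p <= P x).
{ apply (riccati_monotone A u v (fun _ => c) (fun _ => 0)); trivial.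
  - intros y; apply (is_derive_const (K := R_AbsRing) (V := R_NormedModule) c y).
  - intros y Hy; apply Hc; lra. }
apply (Rmult_le_compat_l (P p)) in xL; [|lra].
replace (P p * ((L + 1) / P p)) with (L + 1) in xL by (field; lra).
nra.
Qed.

(* In the coordinate [z = lam * (x - xb)], the Riccati supersolution is the
   parabola [lam * (49/64 * z - z^2/4)] up to its vertex, then a constant. *)
Lemma tail_nonincreasing lam u v xb x :
  193/100 <= lam -> solution (lam ^ 6 / 4) u v -> decaying u v ->
  0 <= xb -> xb ^ 2 = lam ^ 6 / 4 - 49/64 * lam ^ 2 -> xb <= x ->
  u x * v x <= 0.
Proof.
intros l S D xb0 Exb xbx.
assert (l2 : 37/10 <= lam ^ 2) by nra.
assert (l4 : 13 <= lam ^ 4) by (replace (lam ^ 4) with (lam ^ 2 * lam ^ 2) by ring; nra).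
assert (xb1 : 2/5 * lam ^ 3 <= xb).
{ destruct (Rle_or_lt (2/5 * lam ^ 3) xb) as [|H]; [easy|exfalso].
  assert (xb ^ 2 < (2/5 * lam ^ 3) ^ 2) by nra.
  replace (xb ^ 2) with (lam ^ 2 * (lam ^ 4 / 4 - 49/64)) in H0 by (rewrite Exb; field).
  replace ((2/5 * lam ^ 3) ^ 2) with (lam ^ 2 * (4/25 * lam ^ 4)) in H0 by field.
  nra. }
(* The vertex z = 49/32 of the parabola; its value there is [lam * (49/64) ^ 2], the constant used
   beyond it. *)
set (xc := xb + 49/32 / lam).
assert (il : lam * / lam = 1) by (field; lra).
assert (il0 : 0 < / lam) by (apply Rinv_0_lt_compat; lra).
assert (T : forall y, xc <= y -> u y * v y + lam * (49/64) ^ 2 * u y ^ 2 <= 0).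
{ intros y xcy.
  apply (decaying_nonpos (lam ^ 6 / 4)); trivial; [nra|].
  intros t yt.
  assert (xc ^ 2 <= t ^ 2) by (unfold xc, Rdiv in *; nra).
  assert (xb ^ 2 + 2 * xb * (49/32 / lam) <= xc ^ 2)
    by (unfold xc, Rdiv in *; nra).
  assert (49/40 * lam ^ 2 <= 2 * xb * (49/32 / lam)).
  { replace (49/40 * lam ^ 2) with (2 * (2/5 * lam ^ 3) * (49/32 / lam))
      by (field; lra).
    apply Rmult_le_compat_r; [unfold Rdiv; nra | lra]. }
  rewrite Rpow_mult_distr; nra. }
destruct (Rle_or_lt xc x) as [H|H].
- specialize (T x H); pose proof (pow2_ge_0 (u x)); nra.
- set (r := fun t => 49/64 * lam ^ 2 * (t - xb) - lam ^ 3 * (t - xb) ^ 2 / 4).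
  assert (M : u x * v x + r x * u x ^ 2 <= u xc * v xc + r xc * u xc ^ 2).
  { apply (riccati_monotone (lam ^ 6 / 4) u v r
      (fun t => 49/64 * lam ^ 2 - lam ^ 3 * (t - xb) / 2)); [easy | lra | |].
    - intros t; unfold r; auto_derive; [easy|simpl; field].
    - intros t Ht.
      set (z := lam * (t - xb)).
      assert (Hz : 0 <= z <= 49/32).
      { unfold z; split; [nra|].
        replace (49/32) with (lam * (49/32 / lam)) by (field; lra).
        apply Rmult_le_compat_l; unfold xc in *; lra. }
      (* The left side is largest at z = 49/48. The bound 3/10 is what is needed: with the slope
         -4/5 of [E2] it gives 3/10 - 4/5 = -1/2, the slope of [r'] in units of [lam ^ 2 * z]. *)
      assert (Hq : z * (49/64 - z / 4) ^ 2 <= 3/10).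
      { assert (0 <= (z - 49/48) ^ 2 * (49/24 - z)).
        { apply Rmult_le_pos; [apply pow2_ge_0 | lra]. }
        nra. }
      assert (E1 : r t ^ 2 = lam ^ 2 * z * (z * (49/64 - z / 4) ^ 2))
        by (unfold r, z; field).
      assert (E2 : lam ^ 6 / 4 - t ^ 2 <=
                   49/64 * lam ^ 2 - 4/5 * lam ^ 2 * z).
      { replace (t ^ 2) with (xb ^ 2 + 2 * xb * (t - xb) + (t - xb) ^ 2) by ring.
        assert (4/5 * lam ^ 2 * z <= 2 * xb * (t - xb)).
        { replace (4/5 * lam ^ 2 * z) with (2 * (2/5 * lam ^ 3) * (t - xb))
            by (unfold z; field).
          apply Rmult_le_compat_r; lra. }
        pose proof (pow2_ge_0 (t - xb)); lra. }
      replace (lam ^ 3 * (t - xb)) with (lam ^ 2 * z) by (unfold z; ring).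
      rewrite E1.
      assert (0 <= lam ^ 2 * z) by (apply Rmult_le_pos; lra).
      pose proof (Rmult_le_compat_l _ _ _ H0 Hq).
      lra. }
  specialize (T xc (Rle_refl xc)).
  replace (r xc) with (lam * (49/64) ^ 2) in M by (unfold r, xc; field; lra).
  assert (0 <= r x).
  { replace (r x) with (lam ^ 2 * (x - xb) * (49/64 - lam * (x - xb) / 4))
      by (unfold r; field).
    assert (lam * (x - xb) <= lam * (49/32 / lam)).
    { apply Rmult_le_compat_l; unfold xc in *; lra. }
    replace (lam * (49/32 / lam)) with (49/32) in H0 by (field; lra).
    apply Rmult_le_pos; [apply Rmult_le_pos; lra | lra]. }
  pose proof (pow2_ge_0 (u x)); nra.
Qed.

(** * Sturm comparison and a critical point near the turning point *)

(* Sturm comparison with [cos (m (x - p))], which vanishes at the right end. *)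
Lemma cosine_comparison A u v m p :
  solution A u v -> 0 < m ->
  (forall x, p <= x <= p + PI / (2 * m) -> 0 <= u x /\ m ^ 2 <= A - x ^ 2) ->
  0 <= v p.
Proof.
intros S m0 H.
set (q := p + PI / (2 * m)).
pose proof PI_RGT_0 as pi0.
assert (len : 0 < PI / (2 * m)) by (apply Rdiv_lt_0_compat; lra).
assert (pq : p <= q) by (unfold q; lra).
assert (W : - (v p * cos (m * (p - p)) + u p * (m * sin (m * (p - p)))) <=
            - (v q * cos (m * (q - p)) + u q * (m * sin (m * (q - p))))).
{ apply derive_nonneg_le with
    (f := fun x => - (v x * cos (m * (x - p)) + u x * (m * sin (m * (x - p)))))
    (df := fun x => (A - x ^ 2 - m ^ 2) * u x * cos (m * (x - p))); [easy| |].
  - intros x _; destruct (S x) as [Su Sv].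
    auto_derive.
    + repeat split; eexists; first [exact Su | exact Sv].
    + rewrite (is_derive_unique (fun t : R => u t) x _ Su),
        (is_derive_unique (fun t : R => v t) x _ Sv); unfold Rminus; ring.
  - intros x Hx; destruct (H x Hx).
    apply Rmult_le_pos; [apply Rmult_le_pos; lra|].
    assert (0 <= m * (x - p) <= PI / 2).
    { replace (PI / 2) with (m * (PI / (2 * m))) by (field; lra).
      split; [apply Rmult_le_pos; lra|].
      apply Rmult_le_compat_l; unfold q in *; lra. }
    apply cos_ge_0; lra. }
replace (m * (q - p)) with (PI / 2) in W by (unfold q; field; lra).
replace (m * (p - p)) with 0 in W by ring.
rewrite cos_0, sin_0, cos_PI2, sin_PI2 in W.
destruct (H q ltac:(unfold q in *; lra)); nra.
Qed.

(** If v < 0 throughout, the sign of u v at [xb] gives u >= 0 there, hence on the whole interval. A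
    quarter period of cos(lam (x - x1)) fits before [xb], and the comparison yields v >= 0 at [x1],
    a contradiction. *)
Lemma not_decreasing lam u v x1 xb :
  193/100 <= lam -> solution (lam ^ 6 / 4) u v ->
  0 <= x1 -> x1 ^ 2 = lam ^ 6 / 4 - 25/9 * lam ^ 2 ->
  0 <= xb -> xb ^ 2 = lam ^ 6 / 4 - 49/64 * lam ^ 2 ->
  u xb * v xb <= 0 ->
  ~ (forall x, x1 <= x <= xb -> v x < 0).
Proof.
intros l S x10 E1 xb0 Eb Huv Hv.
assert (l2 : 37/10 <= lam ^ 2) by nra.
assert (x1xb : x1 <= xb) by nra.
pose proof PI_RGT_0 as pi0.
(* Leibniz series: pi/4 <= 1 - 1/3 + 1/5. The value is small enough that 25/9 - 26/15 = 47/45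
   exceeds 1. *)
assert (P2 : PI / 2 <= 26/15).
{ destruct (PI_ineq 1) as [_ H].
  unfold tg_alt, PI_tg in H; simpl in H; lra. }
set (d := PI / (2 * lam)).
assert (Ed : lam * d = PI / 2) by (unfold d; field; lra).
assert (d0 : 0 < d) by (apply Rdiv_lt_0_compat; lra).
(* [x^2] grows by at most [lam^2 PI / 2] since [2 x <= lam^3]. *)
assert (Hx : forall x, x1 <= x <= x1 + d -> lam ^ 2 <= lam ^ 6 / 4 - x ^ 2).
{ intros x Hx.
  assert (x ^ 2 <= (x1 + d) ^ 2) by nra.
  assert (il0 : 0 < / lam) by (apply Rinv_0_lt_compat; lra).
  assert (Hd : d <= 26/15 * / lam).
  { replace d with (PI / 2 * / lam) by (unfold d; field; lra); nra. }
  (* The correction 25/9 / lam leaves room for [d] in the bound 2 x1 + d <= lam^3. *)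
  assert (x1 <= lam ^ 3 / 2 - 25/9 * / lam).
  { apply Rsqr_incr_0_var; unfold Rsqr.
    - replace (x1 * x1) with (x1 ^ 2) by ring; rewrite E1.
      replace ((lam ^ 3 / 2 - 25/9 * / lam) * (lam ^ 3 / 2 - 25/9 * / lam)) with
        (lam ^ 6 / 4 - 25/9 * lam ^ 2 + (25/9 * / lam) ^ 2) by (field; lra).
      pose proof (pow2_ge_0 (25/9 * / lam)); lra.
    - replace (lam ^ 3 / 2 - 25/9 * / lam) with
        (/ lam * (lam ^ 2 * lam ^ 2 / 2 - 25/9)) by (field; lra).
      apply Rmult_le_pos; nra. }
  assert ((2 * x1 + d) * d <= lam ^ 3 * d) by (apply Rmult_le_compat_r; lra).
  replace (lam ^ 3 * d) with (lam ^ 2 * (PI / 2)) in H1 by (rewrite <- Ed; ring).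
  nra. }
(* A - x^2 is at least lam^2 at [x1 + d] but only 49/64 lam^2 at [xb]. *)
assert (sub : x1 + d <= xb).
{ specialize (Hx (x1 + d) ltac:(lra)); nra. }
assert (u0 : 0 <= u xb) by (specialize (Hv xb ltac:(lra)); nra).
assert (0 <= v x1).
{ apply (cosine_comparison (lam ^ 6 / 4) u v lam x1); [easy | lra |].
  fold d; intros x Hxd; split; [|now apply Hx].
  enough (- u x <= - u xb) by lra.
  apply derive_nonneg_le with (f := fun t => - u t) (df := fun t => - v t);
    [lra | |].
  - intros t _; apply (is_derive_opp u), S.
  - intros t Ht; specialize (Hv t ltac:(lra)); lra. }
specialize (Hv x1 ltac:(lra)); lra.
Qed.

(** Without a zero, v keeps one sign on the interval; replacing u by -u reduces the positive case to
    the negative one. *)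
Lemma critical_point_exists lam u v x1 xb :
  193/100 <= lam -> solution (lam ^ 6 / 4) u v ->
  0 <= x1 -> x1 ^ 2 = lam ^ 6 / 4 - 25/9 * lam ^ 2 ->
  0 <= xb -> xb ^ 2 = lam ^ 6 / 4 - 49/64 * lam ^ 2 ->
  u xb * v xb <= 0 ->
  exists x, x1 <= x <= xb /\ v x = 0.
Proof.
intros l S x10 E1 xb0 Eb Huv.
assert (x1xb : x1 <= xb) by nra.
assert (Cv : continuity v).
{ intros x; apply derivable_continuous_pt.
  eexists; apply is_derive_Reals, S. }
apply Classical_Prop.NNPP; intros N.
assert (IV : forall x y, x1 <= x <= xb -> x1 <= y <= xb -> 0 < v x * v y).
{ intros x y Hx Hy.
  destruct (Rlt_or_le 0 (v x * v y)) as [|L]; [easy|exfalso; apply N].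
  destruct (IVT_gen v x y 0 Cv) as [z [Hz vz]].
  - unfold Rmin, Rmax; destruct (Rle_dec (v x) (v y)); nra.
  - exists z; split; [|easy].
    unfold Rmin, Rmax in Hz; destruct (Rle_dec x y); lra. }
destruct (Rtotal_order (v x1) 0) as [H|[H|H]].
- apply (not_decreasing lam u v x1 xb); trivial.
  intros x Hx; specialize (IV x1 x ltac:(lra) Hx); nra.
- apply N; exists x1; lra.
- apply (not_decreasing lam (fun x => - u x) (fun x => - v x) x1 xb);
    trivial; [now apply solution_opp | lra |].
  intros x Hx; specialize (IV x1 x ltac:(lra) Hx); nra.
Qed.

(** * The energy: derivative, positivity and growth *)

(* The quadratic form [(w + C''/2) u^2 - C' u v + C v^2] with [C = 1 / w]:
   by the equation its derivative is [C''' / 2 * u^2]. *)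
Definition energy (A : R) (u v : R -> R) (x : R) : R :=
  let w := sqrt (A - x ^ 2) in
  (w + / (2 * w ^ 3) + 3 * x ^ 2 / (2 * w ^ 5)) * u x ^ 2
  - x / w ^ 3 * (u x * v x) + v x ^ 2 / w.

(** This is C'''/2 for C = 1/w, which is nonnegative for x >= 0. *)
Definition energy_rate (A x : R) : R :=
  let w := sqrt (A - x ^ 2) in
  (9 * x / w ^ 5 + 15 * x ^ 3 / w ^ 7) / 2.

Lemma is_derive_root A x :
  0 < A - x ^ 2 ->
  is_derive (fun t => sqrt (A - t ^ 2)) x (- x / sqrt (A - x ^ 2)).
Proof.
intros H; auto_derive; [simpl in H; lra|].
replace (A + - (x * (x * 1))) with (A - x ^ 2) by (simpl; ring).
field; apply Rgt_not_eq, sqrt_lt_R0, H.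
Qed.

Lemma is_derive_energy A u v x :
  solution A u v -> 0 < A - x ^ 2 ->
  is_derive (energy A u v) x (energy_rate A x * u x ^ 2).
Proof.
intros S H; destruct (S x) as [Su Sv].
pose proof (is_derive_root A x H) as Dw.
pose proof (sqrt_lt_R0 _ H) as w0.
pose proof (pow2_sqrt _ (Rlt_le _ _ H)) as Ew.
unfold energy, energy_rate.
set (w := fun t => sqrt (A - t ^ 2)) in *.
change (sqrt (A - x ^ 2)) with (w x) in *.
change (is_derive w x (- x / w x)) in Dw.
apply is_derive_ext with (fun t =>
  (w t + / (2 * w t ^ 3) + 3 * t ^ 2 / (2 * w t ^ 5)) * u t ^ 2
  - t / w t ^ 3 * (u t * v t) + v t ^ 2 / w t); [easy|].
clearbody w.
auto_derive.
- repeat split;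
    first [eexists; first [exact Su | exact Sv | exact Dw] | simpl | idtac];
    apply Rgt_not_eq; repeat apply Rmult_lt_0_compat; lra.
- rewrite (is_derive_unique (fun t : R => u t) x _ Su),
    (is_derive_unique (fun t : R => v t) x _ Sv),
    (is_derive_unique (fun t : R => w t) x _ Dw).
  replace A with (w x ^ 2 + x ^ 2) by lra.
  field; lra.
Qed.

Lemma energy_rate_pos A x : 0 <= x -> 0 < A - x ^ 2 -> 0 <= energy_rate A x.
Proof.
intros x0 H; unfold energy_rate.
pose proof (sqrt_lt_R0 _ H) as w0; set (w := sqrt _) in *; cbv zeta.
pose proof (pow_lt w 5 w0); pose proof (pow_lt w 7 w0); pose proof (pow_le x 3 x0).
assert (0 <= 9 * x / w ^ 5) by (apply Rdiv_le_0_compat; lra).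
assert (0 <= 15 * x ^ 3 / w ^ 7) by (apply Rdiv_le_0_compat; lra).
lra.
Qed.

(** Completing the square in v leaves w u^2 plus a nonnegative multiple of u^2. *)
Lemma energy_ge A u v x :
  0 < A - x ^ 2 -> sqrt (A - x ^ 2) * u x ^ 2 <= energy A u v x.
Proof.
intros H; unfold energy.
pose proof (sqrt_lt_R0 _ H) as w0; set (w := sqrt _) in *; cbv zeta.
replace (_ + _) with
  (w * u x ^ 2 + (/ (2 * w ^ 3) + 5 * x ^ 2 / (4 * w ^ 5)) * u x ^ 2
   + (v x - x / (2 * w ^ 2) * u x) ^ 2 / w) by (field; lra).
pose proof (pow_lt w 3 w0); pose proof (pow_lt w 5 w0).
pose proof (pow2_ge_0 x); pose proof (pow2_ge_0 (u x)).
assert (0 < / (2 * w ^ 3)) by (apply Rinv_0_lt_compat; lra).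
assert (0 <= 5 * x ^ 2 / (4 * w ^ 5)) by (apply Rdiv_le_0_compat; lra).
assert (0 <= (v x - x / (2 * w ^ 2) * u x) ^ 2 / w)
  by (apply Rdiv_le_0_compat; [apply pow2_ge_0 | lra]).
nra.
Qed.

Lemma energy_monotone A u v x :
  solution A u v -> 0 <= x -> 0 < A - x ^ 2 ->
  energy A u v 0 <= energy A u v x.
Proof.
intros S x0 H.
apply derive_nonneg_le with (df := fun t => energy_rate A t * u t ^ 2); [easy| |];
  intros t Ht; assert (0 < A - t ^ 2) by nra.
- now apply is_derive_energy.
- apply Rmult_le_pos; [apply energy_rate_pos; lra | apply pow2_ge_0].
Qed.

(* A primitive of [energy_rate A x / w], which bounds the logarithmic
   derivative of the energy. *)
Definition growth (A x : R) : R :=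
  5/4 * A / (A - x ^ 2) ^ 3 - 3/4 / (A - x ^ 2) ^ 2.

Lemma exp_monotone x y : x <= y -> exp x <= exp y.
Proof.
intros [H|H]; [now apply Rlt_le, exp_increasing | rewrite H; apply Rle_refl].
Qed.

(** Gronwall: by [energy_ge] the derivative of the energy is at most rate/w times the energy, so
    energy times exp(-growth) does not increase. At 0 the growth is 1/(2A^2) > 0, so the factor
    exp(-growth) there is at most 1. *)
Lemma energy_growth A u v x :
  solution A u v -> 0 <= x -> 0 < A - x ^ 2 ->
  energy A u v x <= energy A u v 0 * exp (growth A x).
Proof.
intros S x0 H.
assert (A0 : 0 < A) by nra.
assert (Le : - (energy A u v 0 * exp (- growth A 0)) <=
             - (energy A u v x * exp (- growth A x))).
{ apply derive_nonneg_le with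
    (f := fun t => - (energy A u v t * exp (- growth A t)))
    (df := fun t => exp (- growth A t) * energy_rate A t *
       (/ sqrt (A - t ^ 2) * (energy A u v t - sqrt (A - t ^ 2) * u t ^ 2)));
    [easy| |]; intros t Ht; assert (Hp : 0 < A - t ^ 2) by nra;
    pose proof (sqrt_lt_R0 _ Hp) as w0.
  - pose proof (is_derive_energy A u v t S Hp) as De.
    assert (Dg : is_derive (growth A) t (energy_rate A t / sqrt (A - t ^ 2))).
    { unfold growth; auto_derive.
      - simpl in Hp; repeat split; apply Rgt_not_eq;
          repeat apply Rmult_lt_0_compat; lra.
      - unfold energy_rate.
        pose proof (pow2_sqrt _ (Rlt_le _ _ Hp)) as Ew.
        set (w := sqrt _) in *; cbv zeta.
        replace (A + - (t * (t * 1))) with (w ^ 2) by (rewrite Ew; simpl; ring).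
        replace A with (w ^ 2 + t ^ 2) by lra.
        field; lra. }
    set (g := growth A) in *; set (e := energy A u v) in *.
    clearbody g e.
    auto_derive.
    + repeat split; eexists; first [exact De | exact Dg].
    + rewrite (is_derive_unique (fun t : R => e t) t _ De),
        (is_derive_unique (fun t : R => g t) t _ Dg).
      field; lra.
  - pose proof (energy_ge A u v t Hp).
    apply Rmult_le_pos; apply Rmult_le_pos.
    + apply Rlt_le, exp_pos.
    + apply energy_rate_pos; lra.
    + apply Rlt_le, Rinv_0_lt_compat; lra.
    + lra. }
assert (E0 : 0 <= energy A u v 0).
{ eapply Rle_trans; [|apply energy_ge; lra].
  apply Rmult_le_pos; [apply sqrt_pos | apply pow2_ge_0]. }
assert (G0 : exp (- growth A 0) <= 1).
{ rewrite <- exp_0; apply exp_monotone; unfold growth.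
  replace (_ - _) with (/ (2 * A ^ 2)) by (field; lra).
  pose proof (pow_lt A 2 A0).
  assert (0 < / (2 * A ^ 2)) by (apply Rinv_0_lt_compat; lra); lra. }
replace (energy A u v x) with
  (energy A u v x * exp (- growth A x) * exp (growth A x)).
- apply Rmult_le_compat_r; [apply Rlt_le, exp_pos | nra].
- rewrite Rmult_assoc, <- exp_plus, Rplus_opp_l, exp_0; ring.
Qed.

(** * Two-sided bounds for the maximum of u^2 *)

(** Only the u^2 coefficient survives. With y = w/lam it is lam (y + 3/(8 y^5)) minus 1/w^3, and y
    lies in [7/8, 5/3]. *)
Lemma energy_critical_le lam u v x :
  0 < lam -> v x = 0 ->
  49/64 * lam ^ 2 <= lam ^ 6 / 4 - x ^ 2 <= 25/9 * lam ^ 2 ->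
  energy (lam ^ 6 / 4) u v x <= 141/80 * lam * u x ^ 2.
Proof.
intros l V H; unfold energy; rewrite V.
assert (Hp : 0 < lam ^ 6 / 4 - x ^ 2) by nra.
pose proof (sqrt_lt_R0 _ Hp) as w0.
pose proof (pow2_sqrt _ (Rlt_le _ _ Hp)) as Ew.
set (w := sqrt _) in *; cbv zeta.
set (y := w / lam).
assert (Ey : w = lam * y) by (unfold y; field; lra).
assert (y0 : 0 < y) by (apply Rdiv_lt_0_compat; lra).
assert (Y : 7/8 <= y <= 5/3).
{ assert (7/8 * lam <= w <= 5/3 * lam)
    by (split; apply Rsqr_incr_0_var; unfold Rsqr; nra).
  unfold y; split; [apply -> Rle_div_r | apply <- Rle_div_l]; lra. }
assert (Hy : 8 * y ^ 6 + 3 <= 141/10 * y ^ 5).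
{ enough (3 <= y ^ 5 * (141/10 - 8 * y)) by (simpl in *; nra).
  (* On [a, b] each factor is bounded below separately, by its value at a and at b; four
     subintervals make this sharp enough. *)
  assert (P : forall a b, 0 <= a -> b <= 141/80 -> a <= y <= b ->
    a ^ 5 * (141/10 - 8 * b) <= y ^ 5 * (141/10 - 8 * y)).
  { intros a b a0 Hb Hab; apply Rmult_le_compat; try lra.
    - now apply pow_le.
    - apply pow_incr; lra. }
  destruct (Rle_or_lt y 1); [|destruct (Rle_or_lt y (13/10));
    [|destruct (Rle_or_lt y (8/5))]].
  - specialize (P (7/8) 1); lra.
  - specialize (P 1 (13/10)); lra.
  - specialize (P (13/10) (8/5)); lra.
  - specialize (P (8/5) (5/3)); lra. }
replace (_ + _) with ((w + / (2 * w ^ 3) + 3 * x ^ 2 / (2 * w ^ 5)) * u x ^ 2)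
  by (field; lra).
apply Rmult_le_compat_r; [apply pow2_ge_0|].
replace (x ^ 2) with (lam ^ 6 / 4 - w ^ 2) by lra.
apply Rle_trans with (w + 3/8 * lam ^ 6 / w ^ 5).
- replace (w + _ + _) with (w + 3/8 * lam ^ 6 / w ^ 5 - / w ^ 3) by (field; lra).
  assert (0 < / w ^ 3) by (apply Rinv_0_lt_compat, pow_lt, w0); lra.
- rewrite Ey.
  replace (lam * y + _) with (lam * ((8 * y ^ 6 + 3) / (8 * y ^ 5)))
    by (field; lra).
  pose proof (pow_lt y 5 y0).
  rewrite (Rmult_comm (141/80)); apply Rmult_le_compat_l; [lra|].
  apply <- Rle_div_l; lra.
Qed.

(** By evenness and the tail estimate, the maximum over [0, [xb]] is global. The lower bound on it
    uses the energy at a critical point; the upper one uses w >= 7/8 lam and the growth bound at the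
    maximiser. *)
Lemma max_sqr_bounds lam u v :
  193/100 <= lam -> solution (lam ^ 6 / 4) u v -> decaying u v ->
  (forall x, u (- x) ^ 2 = u x ^ 2) ->
  exists m, is_maximum (fun x => u x ^ 2) m /\
    energy (lam ^ 6 / 4) u v 0 <= 141/80 * lam * m /\
    7/8 * lam * m <= energy (lam ^ 6 / 4) u v 0 * exp (7/10).
Proof.
intros l S D Ev.
assert (l2 : 37/10 <= lam ^ 2) by nra.
assert (l6 : 3 * lam ^ 2 <= lam ^ 6 / 4).
{ replace (lam ^ 6) with (lam ^ 2 * (lam ^ 2 * lam ^ 2)) by ring.
  assert (12 <= lam ^ 2 * lam ^ 2) by nra; nra. }
set (xb := sqrt (lam ^ 6 / 4 - 49/64 * lam ^ 2)).
set (x1 := sqrt (lam ^ 6 / 4 - 25/9 * lam ^ 2)).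
assert (xb0 : 0 <= xb) by apply sqrt_pos.
assert (x10 : 0 <= x1) by apply sqrt_pos.
assert (Eb : xb ^ 2 = lam ^ 6 / 4 - 49/64 * lam ^ 2) by (apply pow2_sqrt; lra).
assert (E1 : x1 ^ 2 = lam ^ 6 / 4 - 25/9 * lam ^ 2) by (apply pow2_sqrt; lra).
assert (Tail : forall x, xb <= x -> u x * v x <= 0)
  by (intros x Hx; now apply (tail_nonincreasing lam u v xb)).
destruct (continuity_ab_maj (fun x => u x ^ 2) 0 xb xb0) as [x0 [Max Hx0]].
{ intros x _; apply derivable_continuous_pt.
  exists (2 * u x * v x); apply is_derive_Reals.
  replace (2 * u x * v x) with (INR 2 * v x * u x ^ pred 2) by (simpl; ring).
  apply is_derive_pow, S. }
assert (All : forall x, u x ^ 2 <= u x0 ^ 2).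
{ enough (P : forall x, 0 <= x -> u x ^ 2 <= u x0 ^ 2).
  { intros x; destruct (Rle_or_lt 0 x); [now apply P|].
    rewrite <- Ev; apply P; lra. }
  intros x Hx; destruct (Rle_or_lt x xb) as [H|H]; [apply Max; lra|].
  apply Rle_trans with (u xb ^ 2); [|apply Max; lra].
  enough (- u xb ^ 2 <= - u x ^ 2) by lra.
  apply derive_nonneg_le with (f := fun t => - u t ^ 2)
    (df := fun t => - (2 * (u t * v t))); [lra| |].
  - intros t _; destruct (S t) as [Su _].
    apply (is_derive_opp (fun t => u t ^ 2)).
    replace (2 * (u t * v t)) with (INR 2 * v t * u t ^ pred 2) by (simpl; ring).
    now apply is_derive_pow.
  - intros t Ht; specialize (Tail t ltac:(lra)); lra. }
exists (u x0 ^ 2); split; [|split].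
- split; [now exists x0 | easy].
- destruct (critical_point_exists lam u v x1 xb) as [x [Hx Vx]]; trivial.
  { apply Tail; lra. }
  assert (49/64 * lam ^ 2 <= lam ^ 6 / 4 - x ^ 2 <= 25/9 * lam ^ 2)
    by (split; nra).
  apply Rle_trans with (energy (lam ^ 6 / 4) u v x);
    [apply energy_monotone; trivial; nra|].
  eapply Rle_trans; [apply energy_critical_le; trivial; lra|].
  apply Rmult_le_compat_l; [lra | apply All].
- assert (Hp : 49/64 * lam ^ 2 <= lam ^ 6 / 4 - x0 ^ 2) by nra.
  assert (Hpos : 0 < lam ^ 6 / 4 - x0 ^ 2) by nra.
  assert (E0 : 0 <= energy (lam ^ 6 / 4) u v 0).
  { eapply Rle_trans; [|apply energy_ge; lra].
    apply Rmult_le_pos; [apply sqrt_pos | apply pow2_ge_0]. }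
  apply Rle_trans with (energy (lam ^ 6 / 4) u v x0).
  + eapply Rle_trans; [|apply energy_ge; lra].
    apply Rmult_le_compat_r; [apply pow2_ge_0|].
    rewrite <- (sqrt_pow2 (7/8 * lam)) by lra.
    apply sqrt_le_1_alt; lra.
  + eapply Rle_trans; [apply energy_growth; trivial; lra|].
    apply Rmult_le_compat_l; [easy|].
    apply exp_monotone; unfold growth.
    set (p := lam ^ 6 / 4 - x0 ^ 2) in *.
    assert (0 <= 3/4 / p ^ 2) by (apply Rdiv_le_0_compat; [lra | now apply pow_lt]).
    (* Since p >= 49/64 lam^2, the quotient is at most (5/16) / (49/64)^3 < 7/10. *)
    enough (5/4 * (lam ^ 6 / 4) / p ^ 3 <= 7/10) by lra.
    apply <- Rle_div_l; [|now apply pow_lt].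
    assert ((49/64 * lam ^ 2) ^ 3 <= p ^ 3) by (apply pow_incr; lra).
    replace ((49/64 * lam ^ 2) ^ 3) with ((49/64) ^ 3 * lam ^ 6) in H0 by ring.
    pose proof (pow_lt lam 6 ltac:(lra)); lra.
Qed.

(** * Application to the Hermite functions *)

Lemma solution_psi n : solution (2 * INR n + 1) (psi n) (dpsi n).
Proof. intros x; split; [apply is_derive_psi | apply is_derive_dpsi]. Qed.

Lemma decaying_psi n : decaying (psi n) (dpsi n).
Proof.
destruct (herm_decay n 1) as [K HK].
assert (HD : exists D, 0 <= D /\
  forall x, 1 <= x -> Rabs (dherm n x * exp (- x ^ 2 / 2)) <= D).
{ destruct n as [|n].
  - exists 0; split; [lra|]; intros x _; cbn [dherm].
    rewrite Rmult_0_l, Rabs_R0; lra.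
  - destruct (herm_decay n 0) as [D HD].
    pose proof (pos_INR (S n)).
    exists (2 * INR (S n) * D); split.
    + specialize (HD 1 (Rle_refl 1)).
      pose proof (Rabs_pos (1 ^ 0 * (herm n 1 * exp (- 1 ^ 2 / 2)))).
      apply Rmult_le_pos; lra.
    + intros x x1; specialize (HD x x1); cbn [dherm].
      rewrite Rmult_assoc, Rabs_mult, Rabs_pos_eq by lra.
      apply Rmult_le_compat_l; [lra|].
      now rewrite pow_O, Rmult_1_l in HD. }
destruct HD as [D [D0 HD]].
exists (D + K); intros x x1; specialize (HK x x1); specialize (HD x x1).
rewrite pow_1 in HK; unfold psi, dpsi; split; [lra|].
replace (_ * _) with
  (dherm n x * exp (- x ^ 2 / 2) + - (x * (herm n x * exp (- x ^ 2 / 2))))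
  by ring.
eapply Rle_trans; [apply Rabs_triang|]; rewrite Rabs_Ropp; lra.
Qed.

Lemma psi_opp_sqr n x : psi n (- x) ^ 2 = psi n x ^ 2.
Proof.
unfold psi; rewrite herm_opp.
replace ((- x) ^ 2) with (x ^ 2) by ring.
replace (((-1) ^ n * herm n x * exp (- x ^ 2 / 2)) ^ 2) with
  (((-1) ^ n * (-1) ^ n) * (herm n x * exp (- x ^ 2 / 2)) ^ 2) by ring.
rewrite <- Rpow_mult_distr; replace (-1 * -1) with 1 by ring.
rewrite pow1; ring.
Qed.

Lemma psi_sqr n x : psi n x ^ 2 = hermite n x ^ 2 * exp (- x ^ 2).
Proof.
rewrite hermite_herm; unfold psi; rewrite Rpow_mult_distr; f_equal.
replace (exp (- x ^ 2 / 2) ^ 2) with (exp (- x ^ 2 / 2) * exp (- x ^ 2 / 2))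
  by ring.
rewrite <- exp_plus; f_equal; field.
Qed.

Lemma herm_even_0_sqr n :
  herm (2 * n) 0 ^ 2 = (INR (fact (2 * n)) / INR (fact n)) ^ 2.
Proof.
rewrite herm_even_0, Rpow_mult_distr.
replace (((-1) ^ n) ^ 2) with ((-1 * -1) ^ n)
  by (rewrite Rpow_mult_distr; ring).
replace (-1 * -1) with 1 by ring; rewrite pow1; ring.
Qed.

(** * Comparison of the energy at 0 with [Ck] *)

Lemma le_of_pow_le n x y : 0 <= y -> x ^ S n <= y ^ S n -> x <= y.
Proof.
intros y0 H; apply Rnot_lt_le; intros N.
pose proof (pow_incr y x n ltac:(lra)); pose proof (pow_lt x n ltac:(lra)).
simpl in H; nra.
Qed.

(** Here c is [Ck] for even k and e the energy at 0, both divided by (k!/(k/2)!)^2. Squaring makes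
    the comparison rational in K. *)
Lemma even_factor_bounds K :
  6 <= K ->
  let c := 2 * K * sqrt (4 * K - 2) / sqrt (8 * K ^ 2 - 8 * K + 3) in
  let e := sqrt (2 * K + 1) + / (2 * sqrt (2 * K + 1) ^ 3) in
  0 < c /\ c <= e <= 11/10 * c.
Proof.
intros HK c e.
assert (s0 : 0 < 4 * K - 2) by lra.
assert (r0 : 0 < 8 * K ^ 2 - 8 * K + 3) by nra.
assert (w0 : 0 < 2 * K + 1) by lra.
assert (c0 : 0 < c).
{ apply Rdiv_lt_0_compat; [apply Rmult_lt_0_compat|]; try apply sqrt_lt_R0; lra. }
assert (Ec : c ^ 2 = 4 * K ^ 2 * (4 * K - 2) / (8 * K ^ 2 - 8 * K + 3)).
{ unfold c; pose proof (sqrt_lt_R0 _ r0).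
  transitivity (4 * K ^ 2 * sqrt (4 * K - 2) ^ 2
                / sqrt (8 * K ^ 2 - 8 * K + 3) ^ 2); [field; lra|].
  rewrite !pow2_sqrt by lra; easy. }
pose proof (sqrt_lt_R0 _ w0) as v0.
pose proof (pow2_sqrt _ (Rlt_le _ _ w0)) as Ew.
set (w := sqrt (2 * K + 1)) in *.
pose proof (Rinv_0_lt_compat (2 * w ^ 3) ltac:(pose proof (pow_lt w 3 v0); lra)).
assert (e0 : 0 < e) by (unfold e; lra).
assert (Ee : e ^ 2 = w ^ 2 + / w ^ 2 + / (4 * (w ^ 2) ^ 3))
  by (unfold e; field; lra).
rewrite Ew in Ee.
split; [easy|]; split; apply (le_of_pow_le 1); try lra;
  rewrite ?(Rpow_mult_distr _ c), Ec, Ee.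
- apply <- Rle_div_l; [|lra].
  assert (H1 : 0 < / (4 * (2 * K + 1) ^ 3)).
  { apply Rinv_0_lt_compat; pose proof (pow_lt _ 3 w0); lra. }
  apply Rle_trans with
    ((2 * K + 1 + / (2 * K + 1)) * (8 * K ^ 2 - 8 * K + 3)); [|nra].
  enough (2 * K - 3 <= / (2 * K + 1) * (8 * K ^ 2 - 8 * K + 3)) by lra.
  rewrite (Rmult_comm (/ _)); apply -> Rle_div_r; nra.
- apply Rle_trans with (2 * K + 2).
  + assert (/ (2 * K + 1) <= / 2) by (apply Rinv_le_contravar; lra).
    assert (/ (4 * (2 * K + 1) ^ 3) <= / 2); [|lra].
    apply Rinv_le_contravar; [lra|].
    pose proof (pow_R1_Rle (2 * K + 1) 3 ltac:(lra)); lra.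
  + replace ((11/10) ^ 2 * (4 * K ^ 2 * (4 * K - 2) / (8 * K ^ 2 - 8 * K + 3)))
      with ((11/10) ^ 2 * (4 * K ^ 2 * (4 * K - 2)) / (8 * K ^ 2 - 8 * K + 3))
      by (field; lra).
    apply -> Rle_div_r; [|lra].
    assert (0 <= K ^ 2 * (K - 6)) by (apply Rmult_le_pos; nra).
    nra.
Qed.

(** The odd counterpart, with common factor k ((k-1)!/((k-1)/2)!)^2; the energy at 0 is now
    H_k'(0)^2 / w with H_k'(0) = 2k H_{k-1}(0). *)
Lemma odd_factor_bounds K :
  6 <= K ->
  let c := sqrt (16 * K ^ 2 - 16 * K + 6) / sqrt (2 * K - 1) in
  let e := 4 * K / sqrt (2 * K + 1) in
  0 < c /\ c <= e <= 11/10 * c.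
Proof.
intros HK c e.
assert (s0 : 0 < 16 * K ^ 2 - 16 * K + 6) by nra.
assert (r0 : 0 < 2 * K - 1) by lra.
assert (w0 : 0 < 2 * K + 1) by lra.
assert (c0 : 0 < c) by (apply Rdiv_lt_0_compat; now apply sqrt_lt_R0).
assert (e0 : 0 < e) by (apply Rdiv_lt_0_compat; [lra | now apply sqrt_lt_R0]).
assert (Ec : c ^ 2 = (16 * K ^ 2 - 16 * K + 6) / (2 * K - 1)).
{ unfold c; pose proof (sqrt_lt_R0 _ r0).
  transitivity (sqrt (16 * K ^ 2 - 16 * K + 6) ^ 2 / sqrt (2 * K - 1) ^ 2);
    [field; lra|].
  rewrite !pow2_sqrt by lra; easy. }
assert (Ee : e ^ 2 = 16 * K ^ 2 / (2 * K + 1)).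
{ unfold e; pose proof (sqrt_lt_R0 _ w0).
  transitivity (16 * K ^ 2 / sqrt (2 * K + 1) ^ 2); [field; lra|].
  rewrite pow2_sqrt by lra; easy. }
assert (K3 : 0 <= K ^ 2 * (K - 6)) by (apply Rmult_le_pos; nra).
split; [easy|]; split; apply (le_of_pow_le 1); try lra;
  rewrite ?(Rpow_mult_distr _ c), Ec, Ee.
- apply <- Rle_div_l; [|lra].
  replace (16 * K ^ 2 / (2 * K + 1) * (2 * K - 1)) with
    (16 * K ^ 2 * (2 * K - 1) / (2 * K + 1)) by (field; lra).
  apply -> Rle_div_r; nra.
- apply <- Rle_div_l; [|lra].
  replace ((11/10) ^ 2 * ((16 * K ^ 2 - 16 * K + 6) / (2 * K - 1)) * (2 * K + 1))
    with ((11/10) ^ 2 * (16 * K ^ 2 - 16 * K + 6) * (2 * K + 1) / (2 * K - 1))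
    by (field; lra).
  apply -> Rle_div_r; nra.
Qed.

(** By parity one of u(0), u'(0) vanishes, so the energy at 0 is a single term sharing its
    factorials with [Ck]. *)
Lemma Ck_energy k :
  (6 <= k)%nat ->
  let E := energy (2 * INR k + 1) (psi k) (dpsi k) 0 in
  0 < Ck k /\ Ck k <= E <= 11/10 * Ck k.
Proof.
intros k6 E.
assert (K6 : 6 <= INR k) by (apply (le_INR 6) in k6; simpl in k6; lra).
enough (exists h c e, 0 < h /\ (0 < c /\ c <= e <= 11/10 * c) /\
          Ck k = h * c /\ E = h * e) as (h & c & e & h0 & [c0 [B1 B2]] & -> & ->).
{ split; [now apply Rmult_lt_0_compat | split; nra]. }
assert (w0 : 0 < sqrt (2 * INR k + 1)) by (apply sqrt_lt_R0; lra).
assert (E0 : E = (sqrt (2 * INR k + 1) + / (2 * sqrt (2 * INR k + 1) ^ 3))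
                   * herm k 0 ^ 2 + dherm k 0 ^ 2 / sqrt (2 * INR k + 1)).
{ unfold E, energy, psi, dpsi.
  replace (2 * INR k + 1 - 0 ^ 2) with (2 * INR k + 1) by ring.
  replace (- 0 ^ 2 / 2) with 0 by field.
  rewrite exp_0; field; lra. }
unfold Ck; destruct (Nat.even k) eqn:Pk.
- apply Nat.even_spec in Pk; destruct Pk as [n ->].
  replace (2 * n / 2)%nat with n
    by (rewrite Nat.mul_comm; symmetry; now apply Nat.div_mul).
  eexists _, _, _; split; [|split; [exact (even_factor_bounds _ K6)|split]].
  + instantiate (1 := (INR (fact (2 * n)) / INR (fact n)) ^ 2).
    apply pow_lt, Rdiv_lt_0_compat; apply INR_fact_lt_0.
  + field; split; [|apply INR_fact_neq_0].
    apply Rgt_not_eq, sqrt_lt_R0; nra.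
  + rewrite E0, herm_even_0_sqr.
    replace (dherm (2 * n) 0) with 0; [field; split; [lra|apply INR_fact_neq_0]|].
    destruct n as [|n]; [easy|].
    replace (2 * S n)%nat with (S (S (2 * n))) by lia.
    cbn [dherm]; rewrite herm_odd_0; ring.
- assert (Ok : Nat.Odd k) by (apply Nat.odd_spec; unfold Nat.odd; now rewrite Pk).
  destruct Ok as [n En].
  assert (Ek : k = S (2 * n)) by lia; clear En Pk; subst k.
  replace (S (2 * n) - 1)%nat with (n * 2)%nat by lia.
  rewrite Nat.div_mul by lia; rewrite (Nat.mul_comm n 2).
  eexists _, _, _; split; [|split; [exact (odd_factor_bounds _ K6)|split]].
  + instantiate (1 := INR (S (2 * n)) * (INR (fact (2 * n)) / INR (fact n)) ^ 2).
    apply Rmult_lt_0_compat; [lra|].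
    apply pow_lt, Rdiv_lt_0_compat; apply INR_fact_lt_0.
  + rewrite fact_simpl, mult_INR.
    field; split; [|apply INR_fact_neq_0].
    apply Rgt_not_eq, sqrt_lt_R0; lra.
  + rewrite E0, herm_odd_0; cbn [dherm].
    rewrite (Rpow_mult_distr _ (herm _ _)), herm_even_0_sqr.
    field; split; [lra | apply INR_fact_neq_0].
Qed.

(** * Sixth-root scales and the final constants *)

Lemma Rpower_inv_pow x n : 0 < x -> (0 < n)%nat -> Rpower x (1 / INR n) ^ n = x.
Proof.
intros x0 n0; rewrite <- Rpower_pow by apply exp_pos.
rewrite Rpower_mult; replace (1 / INR n * INR n) with 1.
- now apply Rpower_1.
- field; apply not_0_INR; lia.
Qed.


Theorem theorem1 : forall k : nat, (6 <= k)%nat ->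
  exists M : R, is_M k M /\
    27 / 61 * Ck k < M /\
    M < 2 / 3 * Ck k *
        exp (15 / 8 * (1 + 12 / (4 * Rpower (2 * INR k) (1 / 3) - 9))).
Proof.
intros k k6.
assert (K6 : 6 <= INR k) by (apply (le_INR 6) in k6; simpl in k6; lra).
destruct (Ck_energy k k6) as [C0 [CE EC]].
assert (El : Rpower (4 * (2 * INR k + 1)) (1 / 6) ^ 6 = 4 * (2 * INR k + 1)).
{ replace 6 with (INR 6) at 1 by (simpl; lra); apply Rpower_inv_pow; [lra|lia]. }
assert (Em : Rpower (2 * INR k) (1 / 6) ^ 6 = 2 * INR k).
{ replace 6 with (INR 6) at 1 by (simpl; lra); apply Rpower_inv_pow; [lra|lia]. }
assert (Ec : Rpower (2 * INR k) (1 / 3) ^ 3 = 2 * INR k).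
{ replace 3 with (INR 3) at 1 by (simpl; lra); apply Rpower_inv_pow; [lra|lia]. }
assert (l0 : 0 < Rpower (4 * (2 * INR k + 1)) (1 / 6)) by apply exp_pos.
set (lam := Rpower (4 * (2 * INR k + 1)) (1 / 6)) in *.
(* Here k >= 6 gives lam^6 >= 52 > 1.93^6. *)
assert (l : 193/100 <= lam) by (apply (le_of_pow_le 5); [lra | lra]).
assert (EA : 2 * INR k + 1 = lam ^ 6 / 4) by lra.
rewrite EA in CE, EC.
destruct (max_sqr_bounds lam (psi k) (dpsi k)) as [m [[[x0 Hx0] Max] [Lo Up]]];
  [easy | rewrite <- EA; apply solution_psi | apply decaying_psi
   | intros x; apply psi_opp_sqr |].
exists (Rpower (2 * INR k) (1 / 6) * m); split.
{ exists m; split; [|easy]; split.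
  - exists x0; now rewrite <- psi_sqr.
  - intros x; rewrite <- psi_sqr; apply Max. }
set (E := energy (lam ^ 6 / 4) (psi k) (dpsi k) 0) in *.
assert (mu0 : 0 < Rpower (2 * INR k) (1 / 6)) by apply exp_pos.
set (mu := Rpower (2 * INR k) (1 / 6)) in *.
assert (m0 : 0 < m) by nra.
split.
(* (lam/mu)^6 = 4 + 2/k <= 13/3 < 1.277^6, and 1.277 times 141/80 is below 61/27. *)
- assert (lam <= 1277/1000 * mu).
  { apply (le_of_pow_le 5); [lra |].
    rewrite Rpow_mult_distr, El, Em; lra. }
  assert (lam * m <= 1277/1000 * mu * m) by (apply Rmult_le_compat_r; lra).
  assert (0 < mu * m) by (apply Rmult_lt_0_compat; lra).
  lra.
- assert (mu <= lam) by (apply (le_of_pow_le 5); [lra | lra]).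
  set (c := Rpower (2 * INR k) (1 / 3)) in *.
  (* c^3 = 2k >= 12 > (9/4)^3, so the denominator in the exponent is positive. *)
  assert (9/4 < c).
  { apply Rnot_le_lt; intros N.
    assert (c ^ 3 <= (9/4) ^ 3)
      by (apply pow_incr; split; [apply Rlt_le, exp_pos | easy]).
    lra. }
  assert (0 < 12 / (4 * c - 9)) by (apply Rdiv_lt_0_compat; lra).
  (* Split 15/8 = 47/40 + 7/10 and use exp(47/40) >= 87/40. It then suffices that 8/7 times 11/10 is
     below 2/3 times 87/40. *)
  assert (X : 87/40 * exp (7/10) <= exp (15 / 8 * (1 + 12 / (4 * c - 9)))).
  { apply Rle_trans with (exp (47/40 + 7/10)); [|apply exp_monotone; lra].
    rewrite exp_plus; apply Rmult_le_compat_r; [apply Rlt_le, exp_pos|].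
    pose proof (exp_ineq1_le (47/40)); lra. }
  pose proof (exp_pos (7/10)) as e0.
  assert (mu * m <= lam * m) by (apply Rmult_le_compat_r; lra).
  assert (E * exp (7/10) <= 11/10 * Ck k * exp (7/10))
    by (apply Rmult_le_compat_r; lra).
  pose proof (Rmult_le_compat_l (Ck k) _ _ (Rlt_le _ _ C0) X).
  assert (0 < Ck k * exp (7/10)) by (apply Rmult_lt_0_compat; lra).
  lra.
Qed.
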